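(* Let $M$ be a Riemannian manifold, let $\mu$ be a Borel probability measure on $M$ and $\nu$ a positive Borel measure on $M$. Let $q\in[1/2,1)$. If $\mu$ is absolutely continuous with respect to the volume measure and $(\mu,\nu)$ satisfies the $L^q$-logarithmic Sobolev inequality (for some constant), then $(\mu,\nu)$ also satisfies a weak logarithmic Sobolev inequality with function $h_{WLS}(s)=c_q\,s^{1-1/q}$ for some positive constant $c_q$.
   Context: $\mathrm{Ent}_\mu(g):=\int g\log(g/\int g\,d\mu)\,d\mu$ for $g\ge0$; $\mathrm{Osc}_\mu(f):=\operatorname{ess\,sup}_\mu f-\operatorname{ess\,inf}_\mu f$. $(\mu,\nu)$ satisfies an $L^q$-logarithmic Sobolev inequality with constant $C_{LS}$ if for all non-negative $f\in C^1(M)$: $[\mathrm{Ent}_\mu(f^{2q})]^{1/q}\le C_{LS}\int|\nabla f|^2d\nu$. $(\mu,\nu)$ satisfies a weak logarithmic Sobolev inequality with function $h_{WLS}$ (positive, non-increasing on $(0,\infty)$) if for all bounded $f\in C^1(M)$ and all $s>0$: $\mathrm{Ent}_\mu(f^2)\le h_{WLS}(s)\int|\nabla f|^2d\nu+s[\mathrm{Osc}_\mu(f)]^2$. *)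

(* Defs.v *)
From HB Require Import structures.
From mathcomp Require Import all_boot all_order all_algebra.
From mathcomp Require Import all_classical all_reals all_analysis.
From mathcomp Require Import ess_sup_inf.

Set Implicit Arguments.
Unset Strict Implicit.
Unset Printing Implicit Defensive.

Import Order.TTheory GRing.Theory Num.Theory.
Import numFieldNormedType.Exports.

Local Open Scope classical_set_scope.
Local Open Scope ring_scope.

(* Lebesgue measure on R^n, n-tuples carrying the product sigma-algebra: the
   product measure on R * R^n is transported to R^n.+1 along (x, t) |-> x :: t,
   starting from the unit mass on the one-point space R^0. *)
Section lebesgue_tuple.
Context {R : realType}.
Let T := measurableTypeR R.

Definition cons_pair n (p : T * n.-tuple T) : n.+1.-tuple T :=
  [the n.+1.-tuple T of p.1 :: p.2].

Lemma measurable_cons_pair n :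
  measurable_fun [set: T * n.-tuple T] (@cons_pair n).
Proof. exact: measurable_cons. Qed.

Section succ.
Variables (n : nat) (m : {sigma_finite_measure set (n.-tuple T) -> \bar R}).

Definition lebesgue_cons : set (n.+1.-tuple T) -> \bar R :=
  pushforward (@lebesgue_measure R \x m)%E (@cons_pair n).

Let lebesgue_cons0 : lebesgue_cons set0 = 0%E.
Proof. by rewrite /lebesgue_cons /pushforward preimage_set0 measure0. Qed.

Let lebesgue_cons_ge0 A : (0 <= lebesgue_cons A)%E.
Proof. by rewrite /lebesgue_cons /pushforward measure_ge0. Qed.

Let lebesgue_cons_sigma_additive : semi_sigma_additive lebesgue_cons.
Proof.
move=> F mF tF mUF; rewrite /lebesgue_cons /pushforward preimage_bigcup.
apply: (measure_semi_sigma_additive (fun i => @cons_pair n @^-1` F i)).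
- by move=> i; rewrite -[X in measurable X]setTI; exact: measurable_cons_pair.
- apply/trivIsetP => /= i j _ _ ij; rewrite -preimage_setI.
  by move/trivIsetP : tF => /(_ _ _ _ _ ij) ->//; rewrite preimage_set0.
- by rewrite -preimage_bigcup -[X in measurable X]setTI;
    exact: measurable_cons_pair.
Qed.

HB.instance Definition _ := isMeasure.Build _ _ _ lebesgue_cons
  lebesgue_cons0 lebesgue_cons_ge0 lebesgue_cons_sigma_additive.

Lemma lebesgue_cons_sigma_finite : sigma_finite [set: n.+1.-tuple T] lebesgue_cons.
Proof.
have /sigma_finiteP[F [FT ndF Foo]] := sigma_finiteT (@lebesgue_measure R).
have /sigma_finiteP[G [GT ndG Goo]] := sigma_finiteT m.
pose split_tuple (t : n.+1.-tuple T) : (T * n.-tuple T)%type :=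
  (thead t, [tuple of behead t]).
have consK : cancel (@cons_pair n) split_tuple.
  by case=> x t; congr pair => //; apply: val_inj.
have mS : measurable_fun [set: n.+1.-tuple T] split_tuple.
  by apply: measurable_fun_pair;
    [exact: measurable_tnth | exact: measurable_behead].
exists (fun k => split_tuple @^-1` (F k `*` G k)).
  rewrite -preimage_bigcup -(preimage_setT split_tuple); congr (_ @^-1` _).
  apply/esym/seteqP; split => // -[x t] _.
  have [i _ Fix] : (\bigcup_i F i) x by rewrite -FT.
  have [j _ Gjt] : (\bigcup_j G j) t by rewrite -GT.
  exists (maxn i j) => //; split => /=.
  - by move: x Fix; exact/subsetPset/ndF/leq_maxl.
  - by move: t Gjt; exact/subsetPset/ndG/leq_maxr.
move=> k; have [mFk Fk_fin] := Foo k; have [mGk Gk_fin] := Goo k.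
have mFG : measurable (F k `*` G k) by exact: measurableX.
split; first by rewrite -[X in measurable X]setTI; exact: mS.
rewrite /lebesgue_cons /pushforward (_ : _ @^-1` _ = F k `*` G k); last first.
  rewrite -comp_preimage (_ : split_tuple \o _ = id) ?preimage_id//.
  exact/funext/consK.
by rewrite product_measure1E// lte_mul_pinfty// ge0_fin_numE.
Qed.

HB.instance Definition _ :=
  Measure_isSigmaFinite.Build _ _ _ lebesgue_cons lebesgue_cons_sigma_finite.

End succ.

Fixpoint lebesgue_tuple n : {sigma_finite_measure set (n.-tuple T) -> \bar R} :=
  match n with
  | 0 => dirac [tuple]
  | k.+1 => lebesgue_cons (lebesgue_tuple k)
  end.

End lebesgue_tuple.

(* On an open set U: f is continuous there and, when k > 0, its partial
   derivatives exist on U and are of class C^(k-1). *)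
Fixpoint Ck_on (R : realType) (n k : nat) (U : set 'rV[R]_n)
    (f : 'rV[R]_n -> R) : Prop :=
  (forall x, U x -> {for x, continuous f}) /\
  match k with
  | 0 => True
  | l.+1 => forall i : 'I_n,
      (forall x, U x -> derivable f x (delta_mx ord0 i)) /\
      Ck_on l U (fun x => 'D_(delta_mx ord0 i) f x)
  end.

(* [chart_inv] is only meaningful on [chart_cod], and [chart_fun] on
   [chart_dom]; both are total functions with junk values elsewhere. *)
Record chart (R : realType) (n : nat) (M : topologicalType) := Chart {
  chart_dom : set M ;
  chart_cod : set 'rV[R]_n ;
  chart_fun :> M -> 'rV[R]_n ;
  chart_inv : 'rV[R]_n -> M ;
  chart_dom_open : open chart_dom ;
  chart_cod_open : open chart_cod ;
  chart_funS : forall x, chart_dom x -> chart_cod (chart_fun x) ;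
  chart_invS : forall p, chart_cod p -> chart_dom (chart_inv p) ;
  chart_funK : forall x, chart_dom x -> chart_inv (chart_fun x) = x ;
  chart_invK : forall p, chart_cod p -> chart_fun (chart_inv p) = p ;
  chart_fun_continuous : forall x, chart_dom x -> {for x, continuous chart_fun} ;
  chart_inv_continuous : forall p, chart_cod p -> {for p, continuous chart_inv}
}.

Definition overlap (R : realType) (n : nat) (M : topologicalType)
    (phi psi : chart R n M) : set 'rV[R]_n :=
  chart_cod phi `&` chart_inv phi @^-1` chart_dom psi.

Definition transition (R : realType) (n : nat) (M : topologicalType)
    (phi psi : chart R n M) : 'rV[R]_n -> 'rV[R]_n :=
  psi \o chart_inv phi.

(* The atlas need not be maximal. *)
Record smoothManifold (R : realType) (n : nat) (M : topologicalType) :=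
  SmoothManifold {
  manifold_hausdorff : hausdorff_space M ;
  manifold_second_countable : @second_countable M ;
  atlas : set (chart R n M) ;
  chart_at : M -> chart R n M ;
  chart_at_atlas : forall x, atlas (chart_at x) ;
  chart_at_dom : forall x, chart_dom (chart_at x) x ;
  transition_smooth : forall phi psi, atlas phi -> atlas psi ->
    forall (j : 'I_n) k,
      Ck_on k (overlap phi psi) (fun p => transition phi psi p ord0 j)
}.

(* [metric phi p] is the Gram matrix of the coordinate frame of [phi] at the
   point of coordinates [p]. Tangent vectors are row vectors and ['J f p] acts
   on them on the right. *)
Record riemannianMetric (R : realType) (n : nat) (M : topologicalType)
    (S : smoothManifold R n M) := RiemannianMetric {
  metric : chart R n M -> 'rV[R]_n -> 'M[R]_n ;
  metric_sym : forall phi p, atlas S phi -> chart_cod phi p ->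
    (metric phi p)^T = metric phi p ;
  metric_posdef : forall phi p (v : 'rV[R]_n), atlas S phi -> chart_cod phi p ->
    v != 0 -> 0 < (v *m metric phi p *m v^T) ord0 ord0 ;
  metric_smooth : forall phi, atlas S phi -> forall (i j : 'I_n) k,
    Ck_on k (chart_cod phi) (fun p => metric phi p i j) ;
  metric_transition : forall phi psi p, atlas S phi -> atlas S psi ->
    overlap phi psi p ->
    metric phi p =
      'J (transition phi psi) p *m metric psi (transition phi psi p)
        *m ('J (transition phi psi) p)^T
}.

Notation borel M := (g_sigma_algebraType (@open M)).

Section riemannian.
Context (R : realType) (n : nat) (M : ptopologicalType).
Variables (S : smoothManifold R n M) (g : riemannianMetric S).

Definition C1 (f : M -> R) : Prop :=
  forall phi, atlas S phi -> Ck_on 1 (chart_cod phi) (f \o chart_inv phi).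

Definition gradient (phi : chart R n M) (f : M -> R) (x : M) : 'rV[R]_n :=
  (\row_i 'D_(delta_mx ord0 i) (f \o chart_inv phi) (phi x))
    *m invmx (metric g phi (phi x)).

Definition sqr_norm_tangent (phi : chart R n M) (x : M) (v : 'rV[R]_n) : R :=
  (v *m metric g phi (phi x) *m v^T) ord0 ord0.

Definition sqr_norm_gradient (f : M -> R) (x : M) : R :=
  sqr_norm_tangent (chart_at S x) x (gradient (chart_at S x) f x).

(* This determines [vol] uniquely, since countably many charts cover [M]. *)
Definition is_riemannian_volume (vol : set (borel M) -> \bar R) : Prop :=
  forall phi, atlas S phi ->
  forall A : set (borel M), measurable A -> A `<=` chart_dom phi ->
    (vol A = \int[@lebesgue_tuple R n]_(t in
               [set t | (phi @` A) (\row_i tnth t i)])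
               (Num.sqrt (\det (metric g phi (\row_i tnth t i))))%:E)%E.

End riemannian.

Section functionals.
Context (d : measure_display) (T : measurableType d) (R : realType).
Variable mu : {measure set T -> \bar R}.
Local Open Scope ereal_scope.

(* For [g >= 0] with infinite mass, the entropy is taken to be [+oo]. Where
   [g] vanishes, so does the integrand. *)
Definition Ent (g : T -> R) : \bar R :=
  let m := \int[mu]_x (g x)%:E in
  if m == +oo then +oo else \int[mu]_x (g x * ln (g x / fine m))%:E.

Definition Osc (f : T -> R) : \bar R :=
  ess_sup mu (EFin \o f) - ess_inf mu (EFin \o f).

End functionals.

Section inequalities.
Context (R : realType) (n : nat) (M : ptopologicalType).
Variables (S : smoothManifold R n M) (g : riemannianMetric S).
Variables mu nu : {measure set (borel M) -> \bar R}.
Local Open Scope ereal_scope.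

Definition Lq_log_sobolev (q C : R) : Prop :=
  forall f : M -> R, C1 S f -> (forall x, (0 <= f x)%R) ->
    Ent mu (fun x => f x `^ (2 * q))%R `^ q^-1
      <= C%:E * \int[nu]_x (sqr_norm_gradient g f x)%:E.

Definition weak_log_sobolev (h : R -> R) : Prop :=
  [/\ (forall s, 0 < s -> 0 < h s)%R,
      (forall s t, 0 < s -> s <= t -> h t <= h s)%R &
      forall f : M -> R, C1 S f -> bounded_fun f -> forall s : R, (0 < s)%R ->
        Ent mu (fun x => f x ^+ 2)%R
          <= (h s)%:E * \int[nu]_x (sqr_norm_gradient g f x)%:E
             + s%:E * Osc mu f ^+ 2].

End inequalities.

(* Main.v *)
(* By Young's inequality it is enough to bound Ent(f^2) by a multiple of
   E^q D^(2-2q), where D is the oscillation of f and E its energy.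
   - Ent(w) is the minimum over t of the integral of the Bregman divergence
     bent t w of x ln x, so pointwise comparisons of bent compare entropies.
     Since 1 <= 1/q <= 2, this yields Ent(F^(1/q)) <= 16 |F|_oo^(1/q-1) Ent(F).
   - The log-Sobolev inequality needs a nonnegative C^1 function, so it is
     applied to g = sqrt((f - c)^2 + m) with m the mean of (f - c)^2; then
     |grad g| <= |grad f|, and Ent((f - c)^2) <= 8 Ent((f - c)^2 + m).
     Hence Ent((f - c)^2) is bounded by a multiple of E^q |f - c|_oo^(2-2q).
   - If |f| <= 2D take c = 0. Otherwise f has a constant sign and its values
     are comparable to one another; taking for c the essential bound of f
     nearest to 0, Ent(f^2) <= 5 Var(|f - c|) <= 5 Ent((f - c)^2), the variance
     being taken around the L^2 norm. *)
Require Import Defs.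
From mathcomp Require Import all_boot all_order all_algebra.
From mathcomp Require Import all_classical all_reals all_analysis.
From mathcomp Require Import ess_sup_inf measurable_realfun.
From mathcomp Require Import ring lra.

Import Order.TTheory GRing.Theory Num.Theory.
Import numFieldNormedType.Exports.

Local Open Scope classical_set_scope.
Local Open Scope ring_scope.

(** * Pointwise inequalities for the Bregman divergence of [x ln x] *)

Section entropy_function.
Local Set Implicit Arguments.
Local Unset Strict Implicit.
Context {R : realType}.
Implicit Types m t w x y p : R.

(** The value of [x ln x] at [w] minus its tangent line at [t]. At [w = 0] the factor [w] kills the
    logarithmic term, leaving [t]. *)
Definition bent t w : R := w * ln (w / t) - w + t.

Lemma ln_le_subr1 x : 0 < x -> ln x <= x - 1.
Proof.
by move=> x0; rewrite -{1}(subrKC 1 x) le_ln1Dx//; lra.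
Qed.

Lemma ln_ge_1subV x : 0 < x -> 1 - x^-1 <= ln x.
Proof.
move=> x0; have := @ln_le_subr1 x^-1; rewrite lnV ?posrE// invr_gt0 => /(_ x0).
lra.
Qed.

Lemma bent_scale t w : t != 0 -> bent t w = t * bent 1 (w / t).
Proof. by move=> t0; rewrite /bent divr1; field. Qed.

Lemma bentxx t : t != 0 -> bent t t = 0.
Proof. by move=> t0; rewrite /bent divff// ln1; ring. Qed.

Lemma bent1_le x : 0 <= x -> bent 1 x <= (x - 1) ^+ 2.
Proof.
rewrite le_eqVlt /bent divr1 => /predU1P[<-|x0]; first lra.
have : x * ln x <= x * (x - 1) by rewrite ler_pM2l ?ln_le_subr1.
lra.
Qed.

(** Inserting [ln (y^2) = 2 ln y >= 2 (1 - 1/y)] bounds the divergence below by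
    [2 (y^2 - y) - y^2 + 1]. *)
Lemma bent1_sqr_ge y : 0 <= y -> (y - 1) ^+ 2 <= bent 1 (y ^+ 2).
Proof.
rewrite le_eqVlt /bent divr1 => /predU1P[<-|y0]; first by rewrite expr0n/=; lra.
rewrite lnXn//.
have : y ^+ 2 * (1 - y^-1) <= y ^+ 2 * ln y by rewrite ler_pM2l ?ln_ge_1subV ?exprn_gt0.
have -> : y ^+ 2 * (1 - y^-1) = y ^+ 2 - y by field; rewrite gt_eqF.
rewrite mulr2n; lra.
Qed.

(** From [ln y <= y - 1], since [2 y^2 (y - 1) - y^2 + 1] factors as the right-hand side. *)
Lemma bent1_sqr_le y : 0 <= y -> bent 1 (y ^+ 2) <= (y - 1) ^+ 2 * (2 * y + 1).
Proof.
rewrite le_eqVlt /bent divr1 => /predU1P[<-|y0]; first by rewrite expr0n/=; lra.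
rewrite lnXn//.
have : y ^+ 2 * ln y <= y ^+ 2 * (y - 1) by rewrite ler_pM2l ?ln_le_subr1 ?exprn_gt0.
rewrite mulr2n; lra.
Qed.

Lemma bent1_ge0 x : 0 <= x -> 0 <= bent 1 x.
Proof.
move=> x0; rewrite -(sqr_sqrtr x0).
exact: le_trans (sqr_ge0 _) (bent1_sqr_ge (sqrtr_ge0 _)).
Qed.

Lemma bent_ge0 t w : 0 < t -> 0 <= w -> 0 <= bent t w.
Proof.
move=> t0 w0; rewrite bent_scale ?gt_eqF// mulr_ge0 ?(ltW t0)// bent1_ge0//.
by rewrite divr_ge0// ltW.
Qed.

Lemma bent_sqr_ge y t : 0 <= y -> 0 < t -> (y - t) ^+ 2 <= bent (t ^+ 2) (y ^+ 2).
Proof.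
move=> y0 t0; rewrite bent_scale ?expf_neq0 ?gt_eqF// -expr_div_n.
have := @bent1_sqr_ge (y / t) (divr_ge0 y0 (ltW t0)).
rewrite -(@ler_pM2l _ (t ^+ 2)) ?exprn_gt0//; apply: le_trans.
by rewrite le_eqVlt; apply/orP; left; apply/eqP; field; rewrite gt_eqF.
Qed.

(** The constant 5 is the maximum of [2 z + 1] for [z = y / t] in [0, 2]. *)
Lemma bent_sqr_le y t : 0 <= y <= 2 * t -> 0 < t ->
  bent (t ^+ 2) (y ^+ 2) <= 5 * (y - t) ^+ 2.
Proof.
move=> /andP[y0 yt] t0; rewrite bent_scale ?expf_neq0 ?gt_eqF// -expr_div_n.
have yt2 : y / t <= 2 by rewrite ler_pdivrMr.
have yt0 : 0 <= y / t by rewrite divr_ge0// ltW.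
have -> : 5 * (y - t) ^+ 2 = t ^+ 2 * ((y / t - 1) ^+ 2 * 5).
  by field; rewrite gt_eqF.
rewrite ler_pM2l ?exprn_gt0//; apply: le_trans (bent1_sqr_le yt0) _.
by rewrite ler_wpM2l ?sqr_ge0//; lra.
Qed.

(** With [y = sqrt x <= 1], [(x - 1)^2 = (y - 1)^2 (y + 1)^2 <= 4 (y - 1)^2], and [bent1_sqr_ge]
    applies. *)
Lemma bent1_lb x : 0 <= x <= 1 -> (x - 1) ^+ 2 <= 4 * bent 1 x.
Proof.
move=> /andP[x0 x1]; rewrite -(sqr_sqrtr x0).
set y := Num.sqrt x; have y0 : 0 <= y by exact: sqrtr_ge0.
have y1 : y <= 1 by rewrite -sqrtr1 ler_wsqrtr.
have : (y - 1) ^+ 2 * (4 - (y + 1) ^+ 2) >= 0.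
  by rewrite mulr_ge0 ?sqr_ge0//; nra.
have := bent1_sqr_ge y0; lra.
Qed.

Lemma ln_ge_sqrt y : 0 < y -> 2 * (1 - y^-1) <= ln (y ^+ 2).
Proof.
by move=> y0; rewrite lnXn// mulr2n; have := ln_ge_1subV y0; lra.
Qed.

(* With z = (1 + x) / 2 and r = sqrt z, the case x > 1 reduces, through
   ln z >= 2 (1 - 1/r), to (r - 1)^2 (5r - 2) >= 0. *)
Lemma bent1_midpoint x : 0 <= x -> bent 1 x <= 16 * bent 1 ((1 + x) / 2).
Proof.
move=> x0; have [x1|x1] := leP x 1.
  (* For [x <= 1] both divergences are comparable to squares. Halving the distance to 1 costs a
     factor 4 and [bent1_lb] another 4. *)
  have := @bent1_lb ((1 + x) / 2); have := bent1_le x0.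
  have -> : ((1 + x) / 2 - 1) ^+ 2 = (x - 1) ^+ 2 / 4 by field.
  move=> ? /(_ ltac:(apply/andP; split; lra)); lra.
pose z := (1 + x) / 2; have zE : x = 2 * z - 1 by rewrite /z; field.
rewrite -/z; move: x1; rewrite zE => z1.
have z0 : 0 < z by lra.
pose r := Num.sqrt z; have rE : z = r ^+ 2 by rewrite sqr_sqrtr// ltW.
have r1 : 1 <= r by rewrite -sqrtr1 ler_wsqrtr//; lra.
have lnz : 2 * (1 - r^-1) <= ln z by rewrite rE ln_ge_sqrt//; lra.
(* Because [2 z - 1 <= z^2]. *)
have lnx : ln (2 * z - 1) <= 2 * ln z.
  rewrite -[2 * ln z]mulrC mulr_natr -lnXn// ler_ln ?posrE ?exprn_gt0//; nra.
rewrite /bent !divr1.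
have h1 : (2 * z - 1) * ln (2 * z - 1) <= (2 * z - 1) * (2 * ln z).
  by rewrite ler_wpM2l//; lra.
suff : 14 * (z - 1) <= (12 * z + 2) * ln z by lra.
apply: (@le_trans _ _ ((12 * z + 2) * (2 * (1 - r^-1)))); last first.
  by rewrite ler_wpM2l//; lra.
have -> : (12 * z + 2) * (2 * (1 - r^-1)) =
    14 * (z - 1) + 2 * (r - 1) ^+ 2 * (5 * r - 2) / r.
  by rewrite rE; field; rewrite gt_eqF//; lra.
by rewrite lerDl divr_ge0 ?mulr_ge0 ?sqr_ge0//; lra.
Qed.

Lemma powR_le_sqr x p : 0 <= x <= 1 -> 1 <= p <= 2 -> x ^+ 2 <= x `^ p <= 1.
Proof.
move=> /andP[]; rewrite le_eqVlt => /predU1P[<- _|x0 x1] /andP[p1 p2].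
  by rewrite powR0 ?expr0n/= ?lexx ?ler01 ?gt_eqF//; lra.
rewrite -powR_mulrn ?(ltW x0)//.
by apply/andP; split; last rewrite -[leRHS](powRr0 x);
  rewrite ger_powR ?x0//; lra.
Qed.

(* For x > 1, [bent 1 (x `^ p) = x `^ p * psi (p * ln x)] with
   psi s = e^-s - 1 + s increasing, which reduces to p = 2; there
   ln x >= 2 (1 - y) with y = x^(-1/2) leaves (1 - y)^3 (3 + y) >= 0. *)
Lemma bent1_powR x p : 0 <= x -> 1 <= p <= 2 ->
  bent 1 (x `^ p) <= 16 * Num.max 1 x `^ (p - 1) * bent 1 x.
Proof.
move=> x0 p12; have /andP[p1 p2] := p12; have [x1|x1] := leP x 1.
  (* For [x <= 1] the chain is [bent 1 (x^p) <= (x^p - 1)^2 <= (x^2 - 1)^2 <= 4 (x - 1)^2 <= 16 bent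
     1 x]. *)
  have /andP[h1 h2] := @powR_le_sqr x p ltac:(by rewrite x0) p12.
  have := @bent1_lb x ltac:(by rewrite x0); rewrite powR1 mulr1.
  have := bent1_le (powR_ge0 x p); set a := x `^ p in h1 h2 *; move=> h3 h4.
  have : (a - 1) ^+ 2 <= (x ^+ 2 - 1) ^+ 2.
    by rewrite -[leLHS]sqrrN -[leRHS]sqrrN ler_sqr ?nnegrE;
      move: h1 h2 {h3 h4} x0 x1; rewrite -?expr2; nra.
  have : (x ^+ 2 - 1) ^+ 2 <= 4 * (x - 1) ^+ 2.
    have -> : (x ^+ 2 - 1) ^+ 2 = (x + 1) ^+ 2 * (x - 1) ^+ 2 by ring.
    by rewrite ler_wpM2r ?sqr_ge0//; nra.
  lra.
have {}x0 : 0 < x by lra.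
rewrite /bent !divr1 ln_powR.
have s0 := ln_gt0 x1; set s := ln x in s0 *.
have xpE : x `^ p = x `^ (p - 1) * x.
  by rewrite mulrC mulr_powRB1 ?(ltW x0)//; lra.
have xp0 : 0 < x `^ p by exact: powR_gt0.
have xp10 : 0 < x `^ (p - 1) by exact: powR_gt0.
(* This is [psi (p s) <= psi (2 s)]: factor [x^-p] out of [x^-2], then use [e^-u >= 1 - u] and
   [x^-p <= 1]. *)
have tail : x `^ (- p) <= x ^- 2 + (2 - p) * s.
  have -> : x ^- 2 = x `^ (- p) * x `^ (- (2 - p)).
    by rewrite -powRD ?(gt_eqF x0) ?implybT// -(powR_mulrn _ (ltW x0)) -powRN;
       congr (_ `^ _); lra.
  have le1 : x `^ (- p) <= 1 by rewrite -[leRHS](powRr0 x) ler_powR//; lra.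
  have ge1 : 1 - (2 - p) * s <= x `^ (- (2 - p)).
    rewrite /powR gt_eqF//; apply: le_trans (expR_ge1Dx _); rewrite -/s; lra.
  have := powR_ge0 x (- p).
  have : 0 <= (2 - p) * s by rewrite mulr_ge0//; lra.
  nra.
pose r := Num.sqrt x; have rE : x = r ^+ 2 by rewrite sqr_sqrtr// ltW.
have r1 : 1 <= r by rewrite -sqrtr1 ler_wsqrtr//; lra.
have ls : 2 * (1 - r^-1) <= s by rewrite /s rE ln_ge_sqrt//; lra.
(* In this case the constant 6 is enough; 16 comes from [x <= 1]. *)
suff key : p * s - 1 + x `^ (- p) <= 6 * (s - 1 + x^-1).
  have : x `^ p * (p * s - 1 + x `^ (- p)) <= x `^ p * (6 * (s - 1 + x^-1)).
    by rewrite ler_pM2l.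
  have -> : x `^ p * (p * s - 1 + x `^ (- p)) = x `^ p * (p * s) - x `^ p + 1.
    by rewrite powRN; field; rewrite gt_eqF.
  have -> : x `^ p * (6 * (s - 1 + x^-1)) = 6 * x `^ (p - 1) * (x * s - x + 1).
    by rewrite xpE; field; rewrite gt_eqF.
  move=> /le_trans; apply; rewrite -!mulrA ler_wpM2r//; last lra.
  rewrite mulr_ge0 ?(ltW xp10)//.
  have := @bent1_ge0 x (ltW x0); rewrite /bent divr1 -/s; lra.
suff : x ^- 2 + 5 <= 4 * s + 6 * x^-1 by lra.
have r0 : 0 < r by lra.
pose y := r^-1; have y1 : y <= 1 by rewrite invf_le1.
have y0 : 0 <= y by rewrite invr_ge0 ltW.
have -> : x^-1 = y ^+ 2 by rewrite rE exprVn.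
have -> : x ^- 2 = y ^+ 4 by rewrite rE -exprM exprVn.
have : 0 <= (1 - y) ^+ 3 * (3 + y).
  by rewrite mulr_ge0 ?exprn_ge0//; lra.
rewrite -/y in ls; nra.
Qed.

End entropy_function.


(** * Entropy of bounded functions as a minimum of integrated divergences *)

Section entropy_of_bounded_functions.
Local Set Implicit Arguments.
Local Unset Strict Implicit.
Context {d : measure_display} {T : measurableType d} {R : realType}.
Variable mu : probability T R.
Implicit Types (f h w : T -> R) (m t q L M : R).

Lemma bounded_integrable f M : measurable_fun [set: T] f ->
  (forall x, `|f x| <= M) -> mu.-integrable [set: T] (EFin \o f).
Proof.
move=> mf fM; apply: measurable_bounded_integrable => //.
  by move: (probability_setT mu) => /= ->; rewrite ltry.
by exists M; split => [|N MN x _]; [exact: num_real|exact: le_trans (ltW MN)].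
Qed.

Lemma integral_prob_cst t : (\int[mu]_x (cst t%:E x) = t%:E)%E.
Proof.
by rewrite integral_cst//; move: (probability_setT mu) => /= ->; rewrite mule1.
Qed.

Lemma measurable_bent w t : measurable_fun [set: T] w ->
  measurable_fun [set: T] (fun x => bent t (w x)).
Proof.
move=> mw; apply: measurable_funD => //; apply: measurable_funB => //.
apply: measurable_funM => //; apply: measurableT_comp; first exact: measurable_ln.
exact: measurable_funM.
Qed.

Lemma bounded_mean w M : measurable_fun [set: T] w ->
  (forall x, 0 <= w x <= M) -> exists2 m, 0 <= m & (\int[mu]_x (w x)%:E = m%:E)%E.
Proof.
move=> mw wM; exists (fine (\int[mu]_x (w x)%:E)%E).
  by apply/fine_ge0/integral_ge0 => x _; rewrite lee_fin; case/andP: (wM x).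
rewrite fineK//; apply: integrable_fin_num => //.
apply: (@bounded_integrable w M) => // x.
by have /andP[w0 ?] := wM x; rewrite ger0_norm.
Qed.

(** [bent t w - w ln (w / m)] is affine in [w], so its integral is its value at the mean [m], which
    is [bent t m]. This excess is nonnegative and vanishes at [t = m]: hence the variational formula
    for the entropy. *)
Lemma integral_bent w M t m : measurable_fun [set: T] w ->
  (forall x, 0 <= w x <= M) -> (\int[mu]_x (w x)%:E = m%:E)%E -> 0 < m -> 0 < t ->
  (\int[mu]_x (bent t (w x))%:E = Ent mu w + (bent t m)%:E)%E.
Proof.
move=> mw wM wm m0 t0; rewrite /Ent wm /=.
pose u x := w x * ln (w x / m).
have mu_u : measurable_fun [set: T] u.
  apply: measurable_funM => //; apply: measurableT_comp; first exact: measurable_ln.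
  exact: measurable_funM.
have iu : mu.-integrable [set: T] (EFin \o u).
  (* For [y = w x / m], the bounds on [bent 1 y] give [y - 1 <= y ln y <= y^2 - y]. *)
  apply: (@bounded_integrable _ (m * ((M / m) ^+ 2 + 1))) => // x.
  have /andP[w0 wxM] := wM x.
  have y0 : 0 <= w x / m by rewrite divr_ge0// ltW.
  have yM : w x / m <= M / m by rewrite ler_pM2r ?invr_gt0.
  have -> : u x = m * (w x / m * ln (w x / m)) by rewrite /u; field; rewrite gt_eqF.
  rewrite normrM gtr0_norm// ler_pM2l//.
  have := bent1_ge0 y0; have := bent1_le y0; rewrite /bent !divr1.
  move=> h1 h2; rewrite ler_norml; apply/andP; split; nra.
have iw : mu.-integrable [set: T] (EFin \o w).
  apply: (@bounded_integrable _ M) => // x.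
  by have /andP[w0 ?] := wM x; rewrite ger0_norm.
have icw : mu.-integrable [set: T] (EFin \o (fun x => (ln (m / t) - 1) * w x)).
  apply: (@bounded_integrable _ (`|ln (m / t) - 1| * M)) => [|x].
    exact: measurable_funM.
  by have /andP[w0 ?] := wM x; rewrite normrM ler_wpM2l// ger0_norm.
have ic : mu.-integrable [set: T] (EFin \o cst t).
  exact: finite_measure_integrable_cst.
have -> : (\int[mu]_x (bent t (w x))%:E =
  \int[mu]_x ((u x)%:E + (((ln (m / t) - 1) * w x)%:E + (cst t x)%:E)))%E.
  apply: eq_integral => x _; congr (_%:E); rewrite /u /bent /=.
  (* Splitting the logarithm of the quotient requires [w x > 0]; where [w] vanishes both sides equal
     [t]. *)
  have /andP[] := wM x; rewrite le_eqVlt => /predU1P[<-|w0] _; first by ring.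
  rewrite !ln_div ?posrE//; ring.
rewrite integralD//; last exact: integrableD.
rewrite integralD//; congr (_ + _)%E.
under eq_integral do rewrite EFinM.
rewrite integralZl// wm integral_prob_cst -EFinM -EFinD.
by congr (_%:E); rewrite /bent; ring.
Qed.

Lemma Ent_eq_bent w M m : measurable_fun [set: T] w ->
  (forall x, 0 <= w x <= M) -> (\int[mu]_x (w x)%:E = m%:E)%E -> 0 < m ->
  Ent mu w = (\int[mu]_x (bent m (w x))%:E)%E.
Proof.
move=> mw wM wm m0; rewrite (integral_bent mw wM wm)//.
by rewrite bentxx ?gt_eqF// adde0.
Qed.

Lemma Ent_le_bent w M m t : measurable_fun [set: T] w ->
  (forall x, 0 <= w x <= M) -> (\int[mu]_x (w x)%:E = m%:E)%E -> 0 < m -> 0 < t ->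
  (Ent mu w <= \int[mu]_x (bent t (w x))%:E)%E.
Proof.
move=> mw wM wm m0 t0; rewrite (integral_bent mw wM wm)//.
by rewrite leeDl// lee_fin bent_ge0// ltW.
Qed.

Lemma Ent_eq0 w M : measurable_fun [set: T] w ->
  (forall x, 0 <= w x <= M) -> (\int[mu]_x (w x)%:E = 0)%E -> Ent mu w = 0%E.
Proof.
move=> mw wM w0; rewrite /Ent w0 /=.
(* With mean 0, the defaults [0^-1 = 0] and [ln 0 = 0] make the integrand vanish identically. *)
by under eq_integral do rewrite invr0 mulr0 ln0// mulr0; rewrite integral0.
Qed.

Lemma Ent_ge0_fin w M : measurable_fun [set: T] w ->
  (forall x, 0 <= w x <= M) -> exists2 e, 0 <= e & Ent mu w = e%:E.
Proof.
move=> mw wM; have [m m0 wm] := bounded_mean mw wM.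
move: m0; rewrite le_eqVlt => /predU1P[m0|m0].
  by exists 0 => //; apply: Ent_eq0 mw wM _; rewrite wm -m0.
have wmono x : 0 <= w x by case/andP: (wM x).
have E := Ent_eq_bent mw wM wm m0.
have E0 : (0 <= Ent mu w)%E.
  by rewrite E integral_ge0// => x _; rewrite lee_fin bent_ge0.
exists (fine (Ent mu w)); first exact: fine_ge0.
rewrite fineK// ge0_fin_numE// E.
have /le_lt_trans : (\int[mu]_x (bent m (w x))%:E <=
    \int[mu]_x (cst (m * (M / m + 1) ^+ 2)%:E x))%E.
  apply: ge0_le_integral => //= [x _||x _]; rewrite ?lee_fin ?bent_ge0//.
  - by apply/measurable_EFinP; exact: measurable_bent.
  - have /andP[w0 wxM] := wM x.
    have y0 : 0 <= w x / m by rewrite divr_ge0// ltW.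
    have yM : w x / m <= M / m by rewrite ler_pM2r ?invr_gt0.
    rewrite bent_scale ?gt_eqF// ler_pM2l//; apply: le_trans (bent1_le y0) _.
    by nra.
by apply; rewrite integral_prob_cst ltry.
Qed.

End entropy_of_bounded_functions.


(** * Comparing entropies under powers, shifts and recentring *)

Section entropy_comparison.
Local Set Implicit Arguments.
Local Unset Strict Implicit.
Context {d : measure_display} {T : measurableType d} {R : realType}.
Variable mu : probability T R.
Implicit Types (f h u w F : T -> R) (m t k q p L M N a b : R).

Lemma mean_ae_le w N m : measurable_fun [set: T] w -> (forall x, 0 <= w x) ->
  0 <= N -> {ae mu, forall x, w x <= N} -> (\int[mu]_x (w x)%:E = m%:E)%E ->
  m <= N.
Proof.
move=> mw w0 N0 wN wm; rewrite -lee_fin -wm -[leRHS](integral_prob_cst mu).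
apply: ae_ge0_le_integral => //.
- by move=> x _; rewrite lee_fin.
- exact/measurable_EFinP.
- by apply: filterS wN => x wxN _; rewrite lee_fin.
Qed.

Lemma Ent_ae_eq f h : measurable_fun [set: T] f -> measurable_fun [set: T] h ->
  {ae mu, forall x, f x = h x} -> Ent mu f = Ent mu h.
Proof.
move=> mf mh fh; rewrite /Ent.
have -> : (\int[mu]_x (f x)%:E = \int[mu]_x (h x)%:E)%E.
  apply: ae_eq_integral => //; do ?exact/measurable_EFinP.
  by apply: filterS fh => x /= ->.
case: ifPn => // _; set m := fine _.
have mln (g : T -> R) : measurable_fun [set: T] g ->
    measurable_fun [set: T] (fun x => (g x * ln (g x / m))%:E).
  move=> mg; apply/measurable_EFinP; apply: measurable_funM => //.
  by apply: measurableT_comp; [exact: measurable_ln|exact: measurable_funM].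
apply: ae_eq_integral => //; do ?exact: mln.
by apply: filterS fh => x /= ->.
Qed.

(** Testing the entropy of [F^p] at the point [k^p] instead of its own mean makes both integrands
    functions of [F / k], compared by [bent1_powR]. The resulting factor [k^(p-1) max(1, F/k)^(p-1)
    = max(k, F)^(p-1)] is at most [N^(p-1)] almost everywhere. *)
Lemma Ent_powR_le F p k M N : 1 <= p <= 2 -> measurable_fun [set: T] F ->
  (forall x, 0 <= F x <= M) -> {ae mu, forall x, F x <= N} ->
  (\int[mu]_x (F x)%:E = k%:E)%E -> 0 < k <= N ->
  (Ent mu (fun x => F x `^ p)%R <= (16 * N `^ (p - 1))%:E * Ent mu F)%E.
Proof.
move=> p12 mF FM FN Fk /andP[k0 kN]; have /andP[p1 p2] := p12.
have F0 x : 0 <= F x by case/andP: (FM x).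
have N0 : 0 <= N by rewrite (le_trans (ltW k0)).
have mFp : measurable_fun [set: T] (fun x => F x `^ p).
  exact: (measurableT_comp (measurable_powR p)).
have FpM x : 0 <= F x `^ p <= M `^ p.
  rewrite powR_ge0/= ge0_ler_powR ?nnegrE//; case/andP: (FM x) => //; first lra.
  exact: le_trans.
have [m m0 Fpm] := bounded_mean mu mFp FpM.
have [e e0 Ee] := Ent_ge0_fin mu mF FM.
move: m0; rewrite le_eqVlt => /predU1P[m0|m0].
  rewrite (Ent_eq0 mFp FpM); last by rewrite Fpm -m0.
  by rewrite Ee -EFinM lee_fin !mulr_ge0 ?powR_ge0.
apply: le_trans (Ent_le_bent mFp FpM Fpm m0 (powR_gt0 p k0)) _.
rewrite (Ent_eq_bent mF FM Fk k0) -ge0_integralZl_EFin//; first last.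
- by rewrite mulr_ge0 ?powR_ge0.
- by apply/measurable_EFinP; exact: measurable_bent.
- by move=> x _; rewrite lee_fin bent_ge0.
apply: ae_ge0_le_integral => //.
- by move=> x _; rewrite lee_fin bent_ge0 ?powR_ge0 ?powR_gt0.
- by apply/measurable_EFinP; exact: measurable_bent.
- by move=> x _; rewrite -EFinM lee_fin !mulr_ge0 ?powR_ge0 ?bent_ge0.
- apply/measurable_EFinP; apply: measurable_funM => //; exact: measurable_bent.
apply: filterS FN => x FxN _; rewrite -EFinM lee_fin.
have y0 : 0 <= F x / k by rewrite divr_ge0// ltW.
rewrite bent_scale ?gt_eqF ?powR_gt0// (bent_scale _ (lt0r_neq0 k0)).
have -> : F x `^ p / k `^ p = (F x / k) `^ p.
  by rewrite powRM ?invr_ge0 ?(ltW k0)// -[k^-1]powR_inv1 ?(ltW k0)// powRAC powR_inv1 ?powR_ge0.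
apply: le_trans (ler_wpM2l (powR_ge0 _ _) (bent1_powR y0 p12)) _.
rewrite mulrA mulrA [leRHS]mulrA ler_wpM2r ?bent1_ge0//.
have -> : k `^ p = k * k `^ (p - 1) by rewrite mulr_powRB1 ?(ltW k0)//; lra.
have -> : k * k `^ (p - 1) * 16 * Num.max 1 (F x / k) `^ (p - 1) =
    16 * k * (k `^ (p - 1) * Num.max 1 (F x / k) `^ (p - 1)) by ring.
have -> : 16 * N `^ (p - 1) * k = 16 * k * N `^ (p - 1) by ring.
rewrite ler_pM2l ?mulr_gt0// -powRM ?(ltW k0)//; last by rewrite le_max ler01.
rewrite ge0_ler_powR ?nnegrE//; first lra.
  by rewrite mulr_ge0 ?(ltW k0)// le_max ler01.
rewrite maxr_pMr ?(ltW k0)// mulr1 ge_max kN/=.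
by rewrite mulrC divfK// gt_eqF.
Qed.

(** The function on the right is the [2q]-th power of [sqrt (h^2 + m)], to which log-Sobolev will
    apply. One passes from [h^2] to [w = h^2 + m] by [bent1_midpoint], then from [w] to [F = w^q] by
    [Ent_powR_le] with [p = 1/q]. *)
Lemma Ent_sqr_le h L M m q : 1 / 2 <= q < 1 -> measurable_fun [set: T] h ->
  (forall x, `|h x| <= M) -> {ae mu, forall x, `|h x| <= L} ->
  (\int[mu]_x (h x ^+ 2)%R%:E = m%:E)%E -> 0 < m ->
  (Ent mu (fun x => h x ^+ 2)%R <=
    (128 * (2 * L ^+ 2) `^ (1 - q))%:E *
      Ent mu (fun x => (h x ^+ 2 + m) `^ q)%R)%E.
Proof.
move=> /andP[q0 q1] mh hM hL hm m0.
have sqle x K : `|h x| <= K -> h x ^+ 2 <= K ^+ 2.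
  move=> hK; rewrite -(real_normK (num_real (h x))) ler_sqr ?nnegrE//.
  exact: le_trans (normr_ge0 _) hK.
have mw : measurable_fun [set: T] (fun x => h x ^+ 2) by exact: measurable_funX.
have wM x : 0 <= h x ^+ 2 <= M ^+ 2 by rewrite sqr_ge0 sqle.
have mL : m <= L ^+ 2.
  apply: mean_ae_le mw _ (sqr_ge0 L) _ hm; first by move=> x; exact: sqr_ge0.
  by apply: filterS hL => x; exact: sqle.
pose w x := h x ^+ 2 + m.
have mw' : measurable_fun [set: T] w by exact: measurable_funD.
have w0 x : 0 < w x by rewrite /w ltr_wpDl ?sqr_ge0.
have w'M x : 0 <= w x <= M ^+ 2 + m.
  by rewrite ltW// lerD2r; case/andP: (wM x).
have w'm : (\int[mu]_x (w x)%:E = (2 * m)%:E)%E.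
  have ih : mu.-integrable [set: T] (EFin \o (fun x => h x ^+ 2)).
    apply: (bounded_integrable _ (M := M ^+ 2)) => // x.
    by rewrite ger0_norm ?sqr_ge0//; case/andP: (wM x).
  rewrite [LHS](@integralD _ _ _ _ _ measurableT _ (EFin \o cst m) ih).
    by rewrite hm (integral_prob_cst mu m) -EFinD; congr (_%:E); ring.
  exact: finite_measure_integrable_cst.
have m20 : 0 < 2 * m by lra.
(* Each entropy is taken at its own mean, [m] and [2 m]. As [w / (2 m)] is the midpoint of 1 and
   [h^2 / m], the factor 16 becomes 8 after doubling the mean. *)
have step1 : (Ent mu (fun x => h x ^+ 2)%R <= 8%:E * Ent mu w)%E.
  rewrite (Ent_eq_bent mw wM hm m0) (Ent_eq_bent mw' w'M w'm m20).
  have mb := measurable_bent (2 * m) mw'.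
  rewrite -ge0_integralZl_EFin//; first last.
  - exact/measurable_EFinP.
  - by move=> x _; rewrite lee_fin bent_ge0// ltW.
  apply: ge0_le_integral => //.
  - by move=> x _; rewrite lee_fin bent_ge0// sqr_ge0.
  - by apply/measurable_EFinP; exact: measurable_bent.
  - by apply/measurable_EFinP; exact: measurable_funM.
  move=> x _; rewrite -EFinM lee_fin (bent_scale _ (lt0r_neq0 m0)).
  rewrite (bent_scale _ (lt0r_neq0 m20)).
  have y0 : 0 <= h x ^+ 2 / m by rewrite divr_ge0 ?sqr_ge0// ltW.
  have := ler_wpM2l (ltW m0) (bent1_midpoint y0).
  rewrite (_ : (1 + h x ^+ 2 / m) / 2 = w x / (2 * m)); first lra.
  by rewrite /w; field; rewrite gt_eqF.
pose F x := w x `^ q.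
have mF : measurable_fun [set: T] F.
  exact: (measurableT_comp (measurable_powR q)).
have q00 : 0 <= q by lra.
have FM x : 0 <= F x <= (M ^+ 2 + m) `^ q.
  rewrite powR_ge0/= ge0_ler_powR ?nnegrE//; case/andP: (w'M x) => //.
  exact: le_trans.
have [k _ Fk] := bounded_mean mu mF FM.
have FN : {ae mu, forall x, F x <= (2 * L ^+ 2) `^ q}.
  apply: filterS hL => x /sqle hxL; rewrite ge0_ler_powR ?nnegrE ?(ltW (w0 x))//.
    by rewrite mulr_ge0 ?sqr_ge0.
  rewrite /w; lra.
(* Adding [m] keeps [F >= m^q], so its mean is positive. *)
have k0 : 0 < k.
  apply: (lt_le_trans (powR_gt0 q m0)).
  rewrite -lee_fin -Fk -[leLHS](integral_prob_cst mu).
  apply: ge0_le_integral => //.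
  - by move=> x _; rewrite lee_fin powR_ge0.
  - exact/measurable_EFinP.
  move=> x _; rewrite lee_fin ge0_ler_powR ?nnegrE ?(ltW (w0 x)) ?(ltW m0)//.
  by rewrite /w lerDr sqr_ge0.
have kN : k <= (2 * L ^+ 2) `^ q.
  by apply: mean_ae_le mF _ (powR_ge0 _ _) FN Fk => x; case/andP: (FM x).
have q0' : 0 < q by lra.
have p12 : 1 <= q^-1 <= 2.
  rewrite -[leLHS]invr1 lef_pV2 ?posrE// ltW//=.
  by rewrite -(invrK 2) lef_pV2 ?posrE// ?invr_gt0//; lra.
apply: le_trans step1 _.
have -> : Ent mu w = Ent mu (fun x => F x `^ q^-1)%R.
  congr Ent; apply/funext => x; rewrite /F -powRrM divff ?gt_eqF//.
  by rewrite powRr1// ltW.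
have := Ent_powR_le p12 mF FM FN Fk; rewrite k0 kN => /(_ isT).
(* The essential bound [N = (2 L^2)^q] gives [N^(1/q - 1) = (2 L^2)^(1-q)], and [128 = 8 * 16]. *)
rewrite -powRrM (_ : q * (q^-1 - 1) = 1 - q); last by field; rewrite gt_eqF.
move=> /(@lee_wpmul2l _ 8%:E) /le_trans; apply; first by rewrite lee_fin.
rewrite muleA -EFinM [leLHS](_ : _ = ((128 * (2 * L ^+ 2) `^ (1 - q))%:E * Ent mu F)%E)//.
by congr (_%:E * _)%E; ring.
Qed.

(** Let [v] be the L^2 norm of [u]. By [bent_sqr_ge] the integral of [(u - v)^2] is at most the
    entropy of [u^2]. Testing the left entropy at [(t + v)^2] costs at most 5 times that integral,
    by [bent_sqr_le], since [u <= t] gives [t + u <= 2 (t + v)]. *)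
Lemma Ent_sqr_shift_le u t M : 0 < t -> measurable_fun [set: T] u ->
  (forall x, 0 <= u x <= M) -> {ae mu, forall x, u x <= t} ->
  (Ent mu (fun x => (t + u x) ^+ 2)%R <= 5%:E * Ent mu (fun x => u x ^+ 2)%R)%E.
Proof.
move=> t0 mu_u uM ut.
have u0 x : 0 <= u x by case/andP: (uM x).
have mw : measurable_fun [set: T] (fun x => u x ^+ 2) by exact: measurable_funX.
have wM x : 0 <= u x ^+ 2 <= M ^+ 2.
  have /andP[h1 h2] := uM x.
  by rewrite sqr_ge0 ler_sqr ?nnegrE// (le_trans h1).
have [m m0 wm] := bounded_mean mu mw wM.
pose v := Num.sqrt m; have v0 : 0 <= v by exact: sqrtr_ge0.
have vE : v ^+ 2 = m by rewrite sqr_sqrtr.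
have mz : measurable_fun [set: T] (fun x => (t + u x) ^+ 2).
  by apply: measurable_funX; exact: measurable_funD.
have zM x : 0 <= (t + u x) ^+ 2 <= (t + M) ^+ 2.
  have /andP[h1 h2] := uM x.
  by rewrite sqr_ge0 ler_sqr ?nnegrE; lra.
have [n n0 zn] := bounded_mean mu mz zM.
have mduv : measurable_fun [set: T] (fun x => (u x - v) ^+ 2).
  by apply: measurable_funX; exact: measurable_funB.
have var_le : (\int[mu]_x ((u x - v) ^+ 2)%R%:E <= Ent mu (fun x => u x ^+ 2)%R)%E.
  move: (m0); rewrite le_eqVlt => /predU1P[m00|mpos].
    have w0 : (\int[mu]_x (u x ^+ 2)%R%:E = 0)%E by rewrite wm -m00.
    rewrite (Ent_eq0 mw wM w0) /v -m00 sqrtr0.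
    by under eq_integral do rewrite subr0; rewrite w0.
  rewrite (Ent_eq_bent mw wM wm mpos); apply: ge0_le_integral => //.
  - by move=> x _; rewrite lee_fin sqr_ge0.
  - exact/measurable_EFinP.
  - by apply/measurable_EFinP; exact: measurable_bent.
  move=> x _; rewrite lee_fin -vE bent_sqr_ge//.
  by rewrite lt_neqAle v0 andbT eq_sym sqrtr_eq0 -ltNge.
apply: (@le_trans _ _ (5%:E * \int[mu]_x ((u x - v) ^+ 2)%R%:E)%E); last first.
  by rewrite lee_wpmul2l// lee_fin.
have npos : 0 < n.
  apply: (@lt_le_trans _ _ (t ^+ 2)); first by rewrite exprn_gt0.
  rewrite -lee_fin -zn -[leLHS](integral_prob_cst mu).
  apply: ge0_le_integral => //.
  - by move=> x _; rewrite lee_fin sqr_ge0.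
  - exact/measurable_EFinP.
  by move=> x _; rewrite lee_fin ler_sqr ?nnegrE ?addr_ge0 ?(ltW t0)// lerDl.
have c0 : 0 < t + v by rewrite ltr_pwDl.
apply: le_trans (Ent_le_bent mz zM zn npos (exprn_gt0 2 c0)) _.
rewrite -ge0_integralZl_EFin//; first last.
- exact/measurable_EFinP.
- by move=> x _; rewrite lee_fin sqr_ge0.
apply: ae_ge0_le_integral => //.
- by move=> x _; rewrite lee_fin bent_ge0 ?sqr_ge0 ?exprn_gt0.
- by apply/measurable_EFinP; exact: measurable_bent.
- by move=> x _; rewrite -EFinM lee_fin mulr_ge0 ?sqr_ge0.
- by apply/measurable_EFinP; exact: measurable_funM.
apply: filterS ut => x uxt _; rewrite -EFinM lee_fin.
apply: le_trans (bent_sqr_le _ c0) _; first by have := u0 x; lra.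
by rewrite (_ : t + u x - (t + v) = u x - v)//; ring.
Qed.

Lemma Ent_sqr_recenter f a b M : measurable_fun [set: T] f ->
  (forall x, `|f x| <= M) -> a <= b -> {ae mu, forall x, a <= f x <= b} ->
  exists c, {ae mu, forall x, `|f x - c| <= 2 * (b - a)} /\
    (Ent mu (fun x => f x ^+ 2)%R <= 5%:E * Ent mu (fun x => (f x - c) ^+ 2)%R)%E.
Proof.
move=> mf fM ab fab.
(* Used with [c] the essential bound nearest to 0 and [t] its absolute value, so that
   [|f| = t + |f - c|]. *)
have shift c t : 0 < t -> {ae mu, forall x, `|f x - c| <= t} ->
    {ae mu, forall x, f x ^+ 2 = (t + `|f x - c|) ^+ 2} ->
    (Ent mu (fun x => f x ^+ 2)%R <= 5%:E * Ent mu (fun x => (f x - c) ^+ 2)%R)%E.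
  move=> t0 fct ft.
  have mu_u : measurable_fun [set: T] (fun x => `|f x - c|).
    by apply: measurableT_comp => //; exact: measurable_funB.
  have uM x : 0 <= `|f x - c| <= M + `|c|.
    by rewrite normr_ge0 (le_trans (ler_normB _ _))// lerD2r.
  rewrite (Ent_ae_eq _ _ ft).
  - have sqE : (fun x => `|f x - c| ^+ 2) = (fun x => (f x - c) ^+ 2).
      by apply/funext => x; rewrite real_normK ?num_real.
    have := Ent_sqr_shift_le t0 mu_u uM fct; rewrite sqE; exact.
  - exact: measurable_funX.
  - by apply: measurable_funX; exact: measurable_funD.
have [/andP[a0 ba]|Na] := boolP ((0 < a) && (b - a <= a)).
  exists a; split.
    by apply: filterS fab => x /andP[h1 h2]; rewrite ger0_norm; lra.
  apply: (shift a a) => //; apply: filterS fab => x /andP[h1 h2].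
    by rewrite ger0_norm; lra.
  by rewrite ger0_norm ?subr_ge0// subrKC.
have [/andP[b0 ba]|Nb] := boolP ((b < 0) && (b - a <= - b)).
  exists b; split.
    by apply: filterS fab => x /andP[h1 h2]; rewrite ler0_norm; lra.
  apply: (shift b (- b)); first lra; apply: filterS fab => x /andP[h1 h2].
    by rewrite ler0_norm; lra.
  by rewrite ler0_norm ?subr_le0//; ring.
(* In the remaining case [a <= b - a] and [- b <= b - a], so [|f| <= 2 (b - a)] almost
   everywhere. *)
exists 0; split.
  apply: filterS fab => x /andP[h1 h2]; rewrite subr0 ler_norml.
  move: Na Nb; rewrite !negb_and -!leNgt -!ltNge.
  by move=> /orP[?|?] /orP[?|?]; apply/andP; split; lra.
under [in leRHS]eq_fun do rewrite subr0.
have wM x : 0 <= f x ^+ 2 <= M ^+ 2.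
  rewrite sqr_ge0/= -(real_normK (num_real (f x))) ler_sqr ?nnegrE//.
  exact: le_trans (normr_ge0 _) (fM x).
have [e e0 ->] := Ent_ge0_fin mu (measurable_funX 2 mf) wM.
by rewrite -EFinM lee_fin; lra.
Qed.

End entropy_comparison.


(** * Directional chain rule and monotonicity of the integral *)

Section composition.
Local Set Implicit Arguments.
Local Unset Strict Implicit.
Context {R : realType}.

Lemma derive_line (V : normedModType R) (F : V -> R) (x v : V) :
  'D_v F x = (fun t : R => F (t *: v + x))^`()%classic 0.
Proof.
rewrite /derive /derive1.
rewrite [X in _ = lim (X @ _)](_ : _ =
  fun h => h^-1 *: ((F \o shift x) (h *: v) - F x))//.
by apply/funext => h; rewrite addr0 scale0r add0r.
Qed.

(** Only a directional derivative of [F] is assumed, so the one-variable chain rule is applied along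
    the line [t *: v + x]. *)
Lemma is_derive_comp (V : normedModType R) (F : V -> R) (phi dphi : R -> R)
    (x v : V) :
  derivable F x v -> (is_derive (F x) 1 phi (dphi (F x))) ->
  derivable (phi \o F) x v /\ 'D_v (phi \o F) x = dphi (F x) * 'D_v F x.
Proof.
move=> dF dphiF; have dL : is_derive (0 : R) 1 (fun t : R => F (t *: v + x)) ('D_v F x).
  apply: DeriveDef; first exact: (derivable1P _ _ _).1 dF.
  by rewrite -derive1E -derive_line.
have dphi0 : is_derive ((fun t : R => F (t *: v + x)) 0) 1 phi (dphi (F x)).
  by rewrite scale0r add0r.
have dC := is_derive1_comp dphi0 dL.
split; first exact: (derivable1P _ _ _).2 (@ex_derive _ _ _ _ _ _ _ dC).
by rewrite derive_line derive1E; exact: (@derive_val _ _ _ _ _ _ _ dC).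
Qed.

(* [\int] of a nonnegative function is a supremum over simple functions, so it
   is monotone even where measurability of the energy density is not known. *)
Lemma ge0_le_integral_nonmeas d (T : measurableType d)
    (mu : {measure set T -> \bar R}) (f1 f2 : T -> \bar R) :
  (forall x, 0 <= f1 x)%E -> (forall x, f1 x <= f2 x)%E ->
  (\int[mu]_x f1 x <= \int[mu]_x f2 x)%E.
Proof.
move=> f10 f12; have f20 x : (0 <= f2 x)%E by exact: le_trans (f12 x).
rewrite !ge0_integralTE//; apply: ereal_sup_le => _ [h hf1 <-].
by exists h => // x; exact: le_trans (hf1 x) (f12 x).
Qed.

End composition.

(** * C^1 functions on the manifold and their energy density *)

Section manifold.
Local Set Implicit Arguments.
Local Unset Strict Implicit.
Context {R : realType} {n : nat} {M : ptopologicalType}.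
Variables (S : smoothManifold R n M) (g : riemannianMetric S).
Implicit Types (f : M -> R) (phi dphi : R -> R).

Lemma C1_continuous f : C1 S f -> continuous f.
Proof.
move=> Cf x; have [Cx _] := Cf _ (chart_at_atlas S x).
have xU := chart_at_dom S x.
have /Cx fc := chart_funS xU.
have cc := chart_fun_continuous xU.
have comp : {for x, continuous ((f \o chart_inv (chart_at S x)) \o chart_at S x)}.
  exact: continuous_comp cc fc.
(* [f] agrees with its chart expression only on the open chart domain, which suffices near [x]. *)
rewrite /continuous_at -[in X in _ --> X](chart_funK xU).
apply: cvg_trans comp; apply: near_eq_cvg.
have : nbhs x (chart_dom (chart_at S x)).
  by apply: open_nbhs_nbhs; split => //; exact: chart_dom_open.
by apply: filterS => y yU /=; rewrite chart_funK.
Qed.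

Lemma C1_measurable f : C1 S f -> measurable_fun [set: borel M] f.
Proof.
move=> /C1_continuous /continuousP cf.
apply: (measurability _ (RGenOpens.measurableE R)).
move=> _ [_ [a [b ->] <-]]; rewrite setTI; apply: sub_sigma_algebra.
exact/cf/interval_open.
Qed.

Lemma C1_comp f phi dphi : C1 S f -> (forall t : R, is_derive t (1 : R) phi (dphi t)) ->
  continuous dphi -> C1 S (phi \o f).
Proof.
move=> Cf dphiP cdphi psi /Cf [cF dF].
have cphi : continuous phi.
  move=> t; apply: differentiable_continuous; apply/derivable1_diffP.
  exact: (@ex_derive _ _ _ _ _ _ _ (dphiP t)).
split=> [p pU|i]; first exact: continuous_comp (cF p pU) (cphi _).
have [dFi [cdFi _]] := dF i.
have chain p : chart_cod psi p -> _ := fun pU =>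
  is_derive_comp (dFi p pU) (dphiP _).
split=> [p /chain[] //|]; split=> // p pU.
(* Continuity of the derivative at [p] requires its formula on a neighbourhood, provided by the open
   chart codomain. *)
have eqD : {near p, (fun x => dphi ((f \o chart_inv psi) x) *
    'D_(delta_mx ord0 i) (f \o chart_inv psi) x) =1
    'D_(delta_mx ord0 i) (phi \o f \o chart_inv psi)}.
  have : nbhs p (chart_cod psi).
    by apply: open_nbhs_nbhs; split => //; exact: chart_cod_open.
  by apply: filterS => y /chain[_ ->].
rewrite /prop_for /continuous_at.
have [_ ->] := chain p pU; apply: cvg_trans (near_eq_cvg eqD) _.
apply: cvgM; last exact: cdFi.
exact: continuous_comp (cF p pU) (cdphi _).
Qed.

Lemma sqr_norm_gradient_ge0 f x : 0 <= sqr_norm_gradient g f x.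
Proof.
rewrite /sqr_norm_gradient /sqr_norm_tangent; set v := gradient _ _ _ _.
have [->|v0] := eqVneq v 0; first by rewrite !mul0mx mxE.
apply/ltW/metric_posdef => //; first exact: chart_at_atlas.
exact/chart_funS/chart_at_dom.
Qed.

(** All partial derivatives in the chart at [x] get the same factor, and the squared norm is
    quadratic. *)
Lemma sqr_norm_gradient_comp f phi dphi x : C1 S f ->
  (forall t : R, is_derive t (1 : R) phi (dphi t)) ->
  sqr_norm_gradient g (phi \o f) x = dphi (f x) ^+ 2 * sqr_norm_gradient g f x.
Proof.
move=> Cf dphiP; rewrite /sqr_norm_gradient /sqr_norm_tangent.
set psi := chart_at S x.
have [_ dF] := Cf _ (chart_at_atlas S x).
have xU := chart_at_dom S x.
have -> : gradient g psi (phi \o f) x = dphi (f x) *: gradient g psi f x.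
  rewrite /gradient scalemxAl; congr (_ *m _); apply/rowP => i; rewrite !mxE.
  have [dFi _] := dF i.
  have [_] := is_derive_comp (dFi _ (chart_funS xU)) (dphiP _).
  by rewrite /= chart_funK.
by rewrite linearZ/= -!scalemxAl -scalemxAr scalerA mxE expr2.
Qed.

End manifold.


(** * Smoothed distance, and the choice of the constant *)

Section smoothing.
Local Set Implicit Arguments.
Local Unset Strict Implicit.
Context {R : realType}.
Implicit Types c m q s t x y e D : R.

(** For [m > 0], a positive C^1 substitute for [|t - c|] with slope at most 1 in absolute value, so
    composing with it does not increase the energy. *)
Definition smooth_dist c m t : R := Num.sqrt ((t - c) ^+ 2 + m).

Lemma is_derive_smooth_dist c m t : 0 < m ->
  is_derive t (1 : R) (smooth_dist c m) ((t - c) / smooth_dist c m t).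
Proof.
move=> m0; pose u t := (t - c) ^+ 2 + m.
have u0 : 0 < u t by rewrite ltr_wpDl ?sqr_ge0.
have du : is_derive t (1 : R) u (2 * (t - c)).
  rewrite /u; apply: is_derive_eq; rewrite /GRing.scale/=; ring.
have := is_derive1_comp (is_derive1_sqrt u0) du.
rewrite (_ : (2 * Num.sqrt (u t))^-1 * (2 * (t - c)) = (t - c) / smooth_dist c m t)//.
by rewrite /smooth_dist -/(u t); field; rewrite gt_eqF// sqrtr_gt0.
Qed.

Lemma continuous_smooth_dist c m : 0 < m -> continuous (smooth_dist c m).
Proof.
move=> m0 t; apply: differentiable_continuous; apply/derivable1_diffP.
exact: (@ex_derive _ _ _ _ _ _ _ (is_derive_smooth_dist c t m0)).
Qed.

Lemma smooth_dist_gt0 c m t : 0 < m -> 0 < smooth_dist c m t.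
Proof. by move=> m0; rewrite sqrtr_gt0 ltr_wpDl ?sqr_ge0. Qed.

Lemma continuous_smooth_dist_derive c m : 0 < m ->
  continuous (fun t => (t - c) / smooth_dist c m t).
Proof.
move=> m0 t; apply: cvgM; first by apply: cvgB => //; exact: cvg_cst.
apply: cvgV; first by rewrite gt_eqF ?smooth_dist_gt0.
exact: continuous_smooth_dist.
Qed.

Lemma smooth_dist_derive_le1 c m t : 0 < m ->
  ((t - c) / smooth_dist c m t) ^+ 2 <= 1.
Proof.
move=> m0; have v0 : 0 < (t - c) ^+ 2 + m by rewrite ltr_wpDl ?sqr_ge0.
rewrite expr_div_n sqr_sqrtr ?(ltW v0)// ler_pdivrMr//; lra.
Qed.

Lemma smooth_dist_powR c m t q : 0 < m ->
  smooth_dist c m t `^ (2 * q) = ((t - c) ^+ 2 + m) `^ q.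
Proof.
move=> m0; rewrite powRrM powR_mulrn ?sqrtr_ge0// sqr_sqrtr//.
by rewrite addr_ge0 ?sqr_ge0 ?ltW.
Qed.

(** A crude Young inequality: both bases are at most [x + y] and the exponents add up to 1. *)
Lemma powR_interp_le x y q : 0 <= x -> 0 <= y -> 0 <= q <= 1 ->
  x `^ (1 - q) * y `^ q <= x + y.
Proof.
move=> x0 y0 /andP[q0 q1].
have h x' y' r : 0 <= r -> 0 <= x' -> x' <= y' -> x' `^ r <= y' `^ r.
  by move=> ? ? xy; rewrite ge0_ler_powR ?nnegrE// (le_trans _ xy).
have z0 : 0 <= x + y by rewrite addr_ge0.
apply: (@le_trans _ _ ((x + y) `^ (1 - q) * (x + y) `^ q)).
  by rewrite ler_pM ?powR_ge0// h//; lra.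
rewrite -powRD; first by rewrite subrK powRr1.
by rewrite subrK oner_eq0.
Qed.

(** Its [q]-th power must absorb [640 = 5 * 128] and the 8 of [2 (2 D)^2 = 8 D^2]. The [+ 1] keeps
    it positive when [C = 0]. *)
Definition wls_cst q (C : R) : R := (640 * 8 `^ (1 - q)) `^ q^-1 * (`|C| + 1).

Lemma wls_cst_gt0 q C : 0 < wls_cst q C.
Proof.
apply: mulr_gt0; last exact: ltr_wpDl.
by apply: powR_gt0; apply: mulr_gt0; [exact: ltr0n|apply: powR_gt0; exact: ltr0n].
Qed.

(** [powR_interp_le] is applied to [s D^2] and the energy term [l]. The exponent [1 - 1/q] makes
    [l^q] contribute [s^(q-1)], cancelling the [s^(1-q)] of the other factor. *)
Lemma wls_tradeoff q C D s e : 1 / 2 <= q < 1 -> 0 < s -> 0 <= e ->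
  5 * (128 * (2 * (2 * D) ^+ 2) `^ (1 - q) * (`|C| * e) `^ q) <=
  wls_cst q C * s `^ (1 - 1 / q) * e + s * D ^+ 2.
Proof.
move=> /andP[q2 q1] s0 e0; have q0 : 0 < q by lra.
rewrite [leRHS]addrC; set l := _ * _ * e.
have l0 : 0 <= l.
  by rewrite mulr_ge0// mulr_ge0 ?powR_ge0// ltW// wls_cst_gt0.
have sD0 : 0 <= s * D ^+ 2 by rewrite mulr_ge0 ?sqr_ge0// ltW.
have q01 : 0 <= q <= 1 by rewrite !ltW.
apply: le_trans _ (powR_interp_le sD0 l0 q01).
have -> : l `^ q = 640 * 8 `^ (1 - q) * ((`|C| + 1) * e) `^ q * (s `^ (1 - q))^-1.
  have A0 := mulr_ge0 (ler0n R 640) (powR_ge0 8 (1 - q)).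
  have C0 : 0 <= `|C| + 1 by rewrite addr_ge0.
  have lE : l = (640 * 8 `^ (1 - q)) `^ q^-1 * ((`|C| + 1) * e) * s `^ (1 - 1 / q).
    by rewrite /l /wls_cst; ring.
  rewrite lE (powRM _ (mulr_ge0 (powR_ge0 _ _) (mulr_ge0 C0 e0)) (powR_ge0 _ _)).
  rewrite (powRM _ (powR_ge0 _ _) (mulr_ge0 C0 e0)).
  congr (_ * _ * _).
    by rewrite -powRrM mulVf ?gt_eqF// (powRr1 A0).
  rewrite -powRrM -powRN; congr (_ `^ _); by field; rewrite gt_eqF.
have -> : 2 * (2 * D) ^+ 2 = 8 * D ^+ 2 by ring.
have := sqr_ge0 D; move: (D ^+ 2) => X X0.
have -> : (8 * X) `^ (1 - q) = 8 `^ (1 - q) * X `^ (1 - q) by rewrite powRM.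
have -> : (s * X) `^ (1 - q) = s `^ (1 - q) * X `^ (1 - q) by rewrite powRM// ltW.
have -> : (`|C| * e) `^ q = `|C| `^ q * e `^ q by rewrite powRM.
have -> : ((`|C| + 1) * e) `^ q = (`|C| + 1) `^ q * e `^ q by rewrite powRM// addr_ge0.
have sq0 : 0 < s `^ (1 - q) by rewrite powR_gt0.
rewrite [leRHS](_ : _ = 640 * 8 `^ (1 - q) * X `^ (1 - q) *
  ((`|C| + 1) `^ q * e `^ q)); last by field; rewrite gt_eqF.
rewrite [leLHS](_ : _ = 640 * 8 `^ (1 - q) * X `^ (1 - q) *
  (`|C| `^ q * e `^ q)); last by ring.
apply: ler_wpM2l; first exact: mulr_ge0 (mulr_ge0 (ler0n R 640) (powR_ge0 _ _)) (powR_ge0 _ _).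
apply: ler_wpM2r; first exact: powR_ge0.
by rewrite ge0_ler_powR ?nnegrE ?addr_ge0 ?(ltW q0)// lerDl.
Qed.

End smoothing.

(** * Oscillation of bounded functions *)

Section oscillation.
Local Set Implicit Arguments.
Local Unset Strict Implicit.
Context {d : measure_display} {T : measurableType d} {R : realType}.
Variable mu : probability T R.

(** The bound [K] and the positive total mass force both essential bounds to be real. *)
Lemma Osc_bounded (f : T -> R) (K : R) : (forall x, `|f x| <= K) ->
  exists a b : R, [/\ a <= b, {ae mu, forall x, a <= f x <= b} &
    Osc mu f = (b - a)%:E].
Proof.
move=> fK; have muT : (0 < mu [set: T])%E.
  by move: (probability_setT mu) => /= ->; rewrite lte01.
have infsup : (ess_inf mu (EFin \o f) <= ess_sup mu (EFin \o f))%E.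
  by apply: ess_sup_gee => //; exact: ess_inf_le.
have supK : (ess_sup mu (EFin \o f) <= K%:E)%E.
  apply: ess_sup_ler => t; rewrite lee_fin.
  exact: le_trans (ler_norm _) (fK t).
have infK : ((- K)%:E <= ess_inf mu (EFin \o f))%E.
  apply: ess_inf_ger => // t; rewrite lee_fin.
  by have := fK t; rewrite ler_norml => /andP[].
have := ess_sup_ge mu (EFin \o f); have := ess_inf_le mu (EFin \o f).
rewrite /Osc.
move: infsup supK infK.
case: (ess_sup _ _) => [b| |]//; case: (ess_inf _ _) => [a| |]//.
rewrite lee_fin => ab _ _ fa fb; exists a, b; split => //.
by apply: filterS2 fa fb => x /=; rewrite !lee_fin => -> ->.
Qed.

End oscillation.

(** * From the L^q to the weak logarithmic Sobolev inequality *)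

Section weak_log_sobolev.
Local Set Implicit Arguments.
Local Unset Strict Implicit.
Context {R : realType} {n : nat} {M : ptopologicalType}.
Variables (S : smoothManifold R n M) (g : riemannianMetric S).
Variables (mu : probability (borel M) R) (nu : {measure set (borel M) -> \bar R}).

Lemma Lq_log_sobolev_Ent_sqr q (C K L c e : R) (f : M -> R) :
  1 / 2 <= q < 1 -> Lq_log_sobolev g mu nu q C -> C1 S f ->
  (forall x, `|f x| <= K) -> {ae mu, forall x, `|f x - c| <= L} ->
  (\int[nu]_x (sqr_norm_gradient g f x)%:E = e%:E)%E ->
  (Ent mu (fun x => (f x - c) ^+ 2)%R <=
    (128 * (2 * L ^+ 2) `^ (1 - q) * (`|C| * e) `^ q)%:E)%E.
Proof.
move=> q12 LS Cf fK fL fe.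
have mf : measurable_fun [set: borel M] f by exact: C1_measurable Cf.
have mh : measurable_fun [set: borel M] (fun x => f x - c) by exact: measurable_funB.
have hK x : `|f x - c| <= K + `|c|.
  by rewrite (le_trans (ler_normB _ _))// lerD2r.
have mw : measurable_fun [set: borel M] (fun x => (f x - c) ^+ 2).
  exact: measurable_funX.
have wK x : 0 <= (f x - c) ^+ 2 <= (K + `|c|) ^+ 2.
  rewrite sqr_ge0/= -(real_normK (num_real (f x - c))) ler_sqr ?nnegrE//.
  exact: le_trans (normr_ge0 _) (hK x).
(* [smooth_dist c m] is differentiable everywhere only for [m > 0]; if the mean [m] is 0, the
   entropy is 0 as well. *)
have [m] := bounded_mean mu mw wK; rewrite le_eqVlt => /predU1P[<- w0|m0 wm].
  by rewrite (Ent_eq0 mw wK w0) lee_fin !mulr_ge0 ?powR_ge0.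
apply: le_trans (Ent_sqr_le q12 mh hK fL wm m0) _.
have /andP[q2 q1] := q12; have q0 : 0 < q by lra.
rewrite [leRHS]EFinM lee_wpmul2l// ?lee_fin ?mulr_ge0 ?powR_ge0//.
pose G := smooth_dist c m \o f.
have dphi := fun t => is_derive_smooth_dist c t m0.
have CG : C1 S G.
  exact: C1_comp Cf dphi (continuous_smooth_dist_derive m0).
have := LS G CG (fun x => ltW (smooth_dist_gt0 c (f x) m0)).
under eq_fun do rewrite /G /= smooth_dist_powR//.
set F := fun x => _.
have mF : measurable_fun [set: borel M] F.
  apply: (measurableT_comp (measurable_powR q)); exact: measurable_funD.
have FK x : 0 <= F x <= ((K + `|c|) ^+ 2 + m) `^ q.
  rewrite powR_ge0/= ge0_ler_powR ?nnegrE ?addr_ge0 ?sqr_ge0 ?(ltW m0) ?(ltW q0)//.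
  by rewrite lerD2r; case/andP: (wK x).
have [E E0 ->] := Ent_ge0_fin mu mF FK.
have eG : (\int[nu]_x (sqr_norm_gradient g G x)%:E <= e%:E)%E.
  rewrite -fe; apply: ge0_le_integral_nonmeas => x; rewrite lee_fin.
    exact: sqr_norm_gradient_ge0.
  rewrite (sqr_norm_gradient_comp _ _ Cf dphi) ler_piMl ?sqr_norm_gradient_ge0//.
  exact: smooth_dist_derive_le1.
have eG0 : (0 <= \int[nu]_x (sqr_norm_gradient g G x)%:E)%E.
  by apply: integral_ge0 => x _; rewrite lee_fin sqr_norm_gradient_ge0.
move: eG eG0; case: (\int[nu]_x _)%E => [e'| |]//; rewrite !lee_fin => e'e e'0.
move=> LSE.
have e0 : 0 <= e by exact: le_trans e'0 e'e.
(* [C] may be negative, so it is replaced by its absolute value before the energy [e'] is raised to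
   [e]. *)
have : E `^ q^-1 <= `|C| * e.
  apply: le_trans LSE _; apply: (@le_trans _ _ (`|C| * e')).
    by rewrite ler_wpM2r// ler_norm.
  by rewrite ler_wpM2l.
move=> /(@ge0_ler_powR _ q (ltW q0) _ _ _ _).
rewrite !nnegrE powR_ge0 mulr_ge0// => /(_ isT isT).
by rewrite -powRrM mulVf ?gt_eqF// powRr1.
Qed.

Lemma Lq_log_sobolev_weak q (C : R) : 1 / 2 <= q < 1 ->
  Lq_log_sobolev g mu nu q C ->
  weak_log_sobolev g mu nu (fun s => wls_cst q C * s `^ (1 - 1 / q)).
Proof.
move=> q12 LS; have /andP[q2 q1] := q12; have q0 : 0 < q by lra.
have c0 := wls_cst_gt0 q C.
split=> [s s0|s t s0 st|f Cf].
- by rewrite mulr_gt0 ?powR_gt0.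
- rewrite ler_pM2l// -(opprK (1 - 1 / q)) !(powRN _ (- _)).
  have q1' : 0 <= - (1 - 1 / q) by rewrite opprB subr_ge0 mul1r invf_ge1// ltW.
  have t0 := lt_le_trans s0 st.
  by rewrite lef_pV2 ?posrE ?powR_gt0// ge0_ler_powR ?nnegrE ?(ltW s0) ?(ltW t0).
rewrite /bounded_near => /pinfty_ex_gt0 [K K0 fK'] s s0.
have fK x : `|f x| <= K by exact: fK'.
have mf : measurable_fun [set: borel M] f by exact: C1_measurable Cf.
have [a [b [ab fab ->]]] := Osc_bounded mu fK.
have [c [fc Ec]] := Ent_sqr_recenter mf fK ab fab.
have I0 : (0 <= \int[nu]_x (sqr_norm_gradient g f x)%:E)%E.
  by apply: integral_ge0 => x _; rewrite lee_fin sqr_norm_gradient_ge0.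
have h0 : 0 < wls_cst q C * s `^ (1 - 1 / q) by rewrite mulr_gt0 ?powR_gt0.
(* If the energy is infinite, the right-hand side is [+oo] because its coefficient is positive. *)
move: I0; case fe: (\int[nu]_x _)%E => [e| |]// e0; last first.
  by rewrite gt0_muley ?lte_fin// -EFin_expe -EFinM addye// leey.
apply: le_trans Ec _.
have := Lq_log_sobolev_Ent_sqr q12 LS Cf fK fc fe.
move=> /(@lee_wpmul2l _ 5%:E) /le_trans; apply; first by rewrite lee_fin.
rewrite -EFin_expe -!EFinM -EFinD lee_fin.
exact: wls_tradeoff.
Qed.

End weak_log_sobolev.

Theorem proposition3p6 (R : realType) (n : nat) (M : ptopologicalType)
    (S : smoothManifold R n M) (g : riemannianMetric S)
    (vol : {measure set (borel M) -> \bar R})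
    (vol_volume : is_riemannian_volume g vol)
    (mu : probability (borel M) R)
    (nu : {measure set (borel M) -> \bar R})
    (q : R) (q_bounds : 1 / 2 <= q < 1)
    (mu_ac : mu `<< vol)
    (LSq : exists C : R, Lq_log_sobolev g mu nu q C) :
  exists c : R, 0 < c /\
    weak_log_sobolev g mu nu (fun s => c * s `^ (1 - 1 / q)).
Proof.
have [C LS] := LSq; exists (wls_cst q C); split; first exact: wls_cst_gt0.
exact: Lq_log_sobolev_weak.
Qed.
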